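(* Let $0\le l\le k$ and $N\ge0$ be integers. Let $\mathbf a\in C^{(k,l)}_{\rm pos}$ and let $(\lambda,\rho)=\iota(\mathbf a)$, $\lambda=(\lambda_1,\dots,\lambda_n)$, $\rho=(\rho_1,\dots,\rho_n)$. Then $a_i=0$ for all $i>N$ if and only if $$\rho_i\le\lambda_iN-\sum_{j\ne i}A_{\lambda_i,\lambda_j}\qquad\text{for all }1\le i\le n.$$
   Context: A configuration is a sequence $\mathbf a=(a_i)_{i\in\mathbb Z}$ of non-negative integers; it is finite if $a_i=0$ for all but finitely many $i$. $C^{(k)}$ is the set of finite configurations with $a_i+a_{i+1}+a_{i+2}\le k$ for all $i$. Put $S[i,\mathbf a]=a_i+a_{i+1}$, $L[i,\mathbf a]=a_{i-1}+2a_i+2a_{i+1}+a_{i+2}$. For $0\le l\le k$, $C^{(k,l)}$ is the set of $\mathbf a\in C^{(k)}$ with $S[i,\mathbf a]\le l$ and $L[i,\mathbf a]\le k+l$ for all $i$ (so $C^{(k,0)}=\{\mathbf 0\}$). $C^{(k,l)}_{\rm pos}$ is the set of $\mathbf a\in C^{(k,l)}$ with $a_i=0$ for all $i<0$. For $1\le l\le k$, $\underline C^{(k,l)}=C^{(k,l)}\setminus C^{(k,l-1)}$. Put $A_{l,l'}=2\min(l,l')+\max(l+l'-k,0)$. A rigged partition is a pair $(\lambda,\rho)$ with $\lambda=(\lambda_1\ge\dots\ge\lambda_n\ge1)$ a partition ($n\ge0$) and $\rho\in\mathbb Z^n$ such that $\rho_i\ge\rho_{i+1}$ whenever $\lambda_i=\lambda_{i+1}$;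 $\emptyset$ denotes the one with $n=0$. For $\mathbf a\in\underline C^{(k,l)}$, $l\ge1$, let $i_1$ be the largest integer $i$ with $S[i,\mathbf a]=l$ or $L[i,\mathbf a]=k+l$; the right move $M_+\mathbf a\in\underline C^{(k,l)}$ is obtained from $\mathbf a$ by replacing $(a_{i_1},a_{i_1+1})$ by $(a_{i_1}-1,a_{i_1+1}+1)$. $\mathbf a\in\underline C^{(k,l)}$ contains a free particle of weight $l$ at the highest position $i$ if $a_i+a_{i+1}=l$, $a_i\ne0$ and $a_j=0$ for all $j\ge i+2$. The map $\iota$ from $C^{(k)}$ to rigged partitions is defined inductively on $\sum_ia_i$: $\iota(\mathbf 0)=\emptyset$. For $\mathbf a\ne\mathbf 0$ let $l_0\ge1$ be the integer with $\mathbf a\in\underline C^{(k,l_0)}$. For all sufficiently large $t$, $M_+^t\mathbf a$ contains a free particle of weight $l_0$ at the highest position $i$ for some $i$; with $c=(M_+^t\mathbf a)_i$ put $d=ic+(i+1)(l_0-c)$, $s=d-t$, and let $\overline{\mathbf a}$ be obtained from $M_+^t\mathbf a$ by setting the entries at columns $i,i+1$ to $0$ ($s$ and $\overline{\mathbf a}$ do not depend on $t$). If $\iota(\overline{\mathbf a})=(\overline\lambda,\overline\rho)$, then $\iota(\mathbf a)=((l_0,\overline\lambda),(\rho_1,\overline\rho))$ with $\rho_1=s-\sum_jA_{l_0,\overline\lambda_j}$. *)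

(* Defs.v *)
From mathcomp Require Import all_boot all_order all_algebra finmap.
From mathcomp Require Import boolp classical_sets.

Set Implicit Arguments.
Unset Strict Implicit.
Unset Printing Implicit Defensive.

Import Order.TTheory GRing.Theory Num.Theory.

Definition config := {fsfun int -> nat with 0%N}.

Definition zero_config : config := [fsfun].

Section Configurations.
Local Open Scope nat_scope.

Implicit Types (a : config) (i : int) (k l : nat).

Definition S_ a i : nat := a i + a (i + 1)%R.

Definition L_ a i : nat :=
  a (i - 1)%R + 2 * a i + 2 * a (i + 1)%R + a (i + 2)%R.

Definition inCk k a : Prop :=
  forall i, a i + a (i + 1)%R + a (i + 2)%R <= k.

Definition inC k l a : Prop :=
  [/\ inCk k a, forall i, S_ a i <= l & forall i, L_ a i <= k + l].

Definition inCpos k l a : Prop :=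
  inC k l a /\ forall i, (i < 0)%R -> a i = 0.

(* Only meant for 1 <= l <= k. *)
Definition inCunder k l a : Prop := inC k l a /\ ~ inC k l.-1 a.

(* The truncated difference is max(l + m - k, 0). *)
Definition A_ k l m : nat := 2 * minn l m + (l + m - k).

Definition is_largest (P : int -> Prop) i : Prop :=
  P i /\ forall j, P j -> (j <= i)%R.

(* The column i_1; the default value 0 of xget is never used when a lies in
   inCunder k l with 1 <= l <= k. *)
Definition move_col k l a : int :=
  xget 0%R [set i | is_largest
    (fun j => S_ a j = l \/ L_ a j = k + l) i]%classic.

(* On inCunder k l (1 <= l <= k), the entry at move_col k l a is positive, so
   the truncated predecessor is the subtraction of 1. *)
Definition Mplus k l a : config :=
  let i1 := move_col k l a in
  [fsfun a with i1 |-> (a i1).-1, (i1 + 1)%R |-> (a (i1 + 1)%R).+1].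

Definition free_particle l a i : Prop :=
  [/\ a i + a (i + 1)%R = l, a i <> 0 &
      forall j, (i + 2 <= j)%R -> a j = 0].

Definition remove_particle a i : config :=
  [fsfun a with i |-> 0, (i + 1)%R |-> 0].

End Configurations.

Local Open Scope ring_scope.

Definition particle_energy (l : nat) (a : config) (i : int) : int :=
  i * (a i)%:Z + (i + 1) * (l%:Z - (a i)%:Z).

(* Peeling off the heaviest particle of a: for all sufficiently large t the
   configuration M_+^t a has a free particle of weight l at some highest
   position, s = d - t, and abar is what is left after removing it. *)
Definition peels_to (k l : nat) (a : config) (s : int) (abar : config) : Prop :=
  exists T : nat, forall t : nat, (T <= t)%N ->
    let b := iter t (Mplus k l) a in
    exists i : int,
      [/\ free_particle l b i,
          s = particle_energy l b i - t%:Z &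
          abar = remove_particle b i].

(* The graph of the inductively defined map iota. *)
Inductive iota_graph (k : nat) : config -> seq nat * seq int -> Prop :=
| iota_zero : iota_graph k zero_config ([::], [::])
| iota_cons (a abar : config) (l0 : nat) (s : int)
    (lam : seq nat) (rho : seq int) :
    (1 <= l0 <= k)%N -> inCunder k l0 a ->
    peels_to k l0 a s abar ->
    iota_graph k abar (lam, rho) ->
    iota_graph k a
      (l0 :: lam, (s - (\sum_(m <- lam) A_ k l0 m)%N%:Z) :: rho).

(* A rigged partition (lambda, rho) is represented by its two sequences, which
   iota_graph makes of equal length; that lambda is nonincreasing, and rho
   nonincreasing where lambda is constant, holds for the values of iota and is
   not imposed.  The relation iota_graph k is single-valued and total on
   inCk k, so the default value ([::], [::]) of xget is not used there. *)
Definition iota_map (k : nat) (a : config) : seq nat * seq int :=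
  xget ([::], [::]) [set p | iota_graph k a p]%classic.

(* Main.v *)
Require Import Defs.
From mathcomp Require Import all_boot all_order all_algebra finmap.
From mathcomp Require Import boolp classical_sets.
From mathcomp Require Import zify.

(** Say that a configuration has height at most [N] if it vanishes beyond column
    [N].  Let [a] have level [n], and let [s] and [abar] be the position and the
    remainder obtained by peeling off its heaviest particle, which has weight
    [n].

    Right moves of [a] can be performed within the columns up to [N] until the
    heaviest particle has been squeezed into column [N] alone ([reach_wall]);
    they are injective ([Mplus_inj]) and never lower the height.  Hence [a] has
    height at most [N] if and only if [s <= n N] and there is room for [n]
    units in column [N] next to [abar].  The first condition is the inequality
    for the rigging of the heaviest particle, because the interaction terms on
    both sides are the same.  The second one must be turned into the
    inequalities for the other particles, and it is not of the form: [abar] has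
    height at most some [N'].

    To bring it to this form, let a further particle of weight [n] travel
    through [abar] from right to left ([carrier], [passes], [crosses]).  There is
    room for [n] units in column [N] exactly when the configuration [g] left
    behind has height at most [N] ([crosses_height]).  On the other hand, the
    crossing keeps the weights and raises the rigging of each particle of weight
    [m] by the interaction [A_ k n m] ([crosses_iota]).  So the inequalities for
    [g], which has one particle less than [a], are the remaining inequalities
    for [a], and induction applies ([height_peel], [height_riggings]).

    The effect of a crossing on the riggings follows from one fact: a crossing
    by a particle of weight [l] commutes with the right moves of every level up
    to [l] ([crosses_Mplus]).  Thanks to it the heaviest particle of [abar] can
    be moved far to the right before the crossing; there it is isolated, and an
    explicit computation shows that its energy changes by the interaction while
    the rest is crossed as if it were alone ([crossed_particle]). *)

Set Implicit Arguments.
Unset Strict Implicit.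
Unset Printing Implicit Defensive.

Import Order.TTheory GRing.Theory Num.Theory.
Local Open Scope ring_scope.

(** * Columns and the right move *)

(** Linear arithmetic treats [a (m + 1 + 1)] and [a (m + 2)] as unrelated
    quantities; this tactic brings every column of the goal to the form [m + z]
    with [z] a numeral, so that equal columns become syntactically equal. *)
Ltac shift_columns m :=
  repeat match goal with
  | |- context [(m + ?x + ?y)%R] =>
      let z := eval vm_compute in (x + y : int)%R in
      lazymatch z with
      | Posz 0 => rewrite (_ : m + x + y = m); [|by rewrite -addrA addr0]
      | _ => rewrite (_ : m + x + y = m + z); [|by rewrite -addrA]
      end
  | |- context [(m + ?x)%R] =>
      lazymatch x with
      | Posz _ => fail
      | Negz _ => fail
      | _ => let z := eval vm_compute in (x : int) in
             change (m + x)%R with (m + z)%R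
      end
  end.

Definition triple (a : config) (m : int) : nat :=
  (a m + a (m + 1)%R + a (m + 2)%R)%N.

Definition saturated k l (a : config) (j : int) : Prop :=
  S_ a j = l \/ L_ a j = (k + l)%N.

(** One unit hops from column [i] to column [i + 1].  Putting the two Kronecker
    deltas on opposite sides keeps the relation free of subtraction. *)
Definition hop (a b : config) (i : int) : Prop :=
  forall m : int, (b m + (m == i)%R)%N = (a m + (m == i + 1)%R)%N.

(** The bounds on [L] and on [S] interact only through this identity, which is
    what most of the linear arithmetic below rests on. *)
Lemma L_S a (m : int) : L_ a (m + 1) = (S_ a m + S_ a (m + 1) + S_ a (m + 2))%N.
Proof. by rewrite /L_ /S_; shift_columns m; lia. Qed.

Lemma hop_S a b i (m : int) : hop a b i ->
  (S_ b m + (m == i - 1)%R)%N = (S_ a m + (m == i + 1)%R)%N.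
Proof. by move=> H; have := H m; have := H (m + 1); rewrite /S_; lia. Qed.

Lemma hop_triple a b i (m : int) : hop a b i ->
  (triple b m + (m == i - 2)%R)%N = (triple a m + (m == i + 1)%R)%N.
Proof.
move=> H; have := H m; have := H (m + 1); have := H (m + 2).
by rewrite /triple; lia.
Qed.

Lemma hop_L a b i (m : int) : hop a b i ->
  (L_ b m + (m == i - 2)%R + (m == i - 1)%R)%N =
  (L_ a m + (m == i + 1)%R + (m == i + 2)%R)%N.
Proof.
move=> H; have := H (m - 1); have := H m; have := H (m + 1).
by have := H (m + 2); rewrite /L_; lia.
Qed.

(** This is why the column of the right move never goes back to the left. *)
Lemma hop_saturated k l a b i :
  hop a b i -> saturated k l b i <-> saturated k l a i.
Proof.
move=> H; have := hop_S i H; have := hop_L i H.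
by rewrite /saturated; lia.
Qed.

Lemma hop_height a b i (N : int) : hop a b i ->
  (forall m : int, N < m -> b m = 0%N) -> forall m : int, N < m -> a m = 0%N.
Proof.
move=> H bN m Nm.
have [e|ne] := eqVneq m i.
  by have := H (i + 1); rewrite bN; subst; lia.
by have := H m; rewrite bN //; lia.
Qed.

Lemma inC_le k l l' a : (l <= l')%N -> inC k l a -> inC k l' a.
Proof. by move=> ll' [C CS CL]; split=> // i; [have := CS i|have := CL i]; lia. Qed.

Lemma inCunderP k l a : (0 < l)%N ->
  inCunder k l a <-> inC k l a /\ exists j, saturated k l a j.
Proof.
move=> l0; split=> -[Ca H]; split=> //.
  have [C CS CL] := Ca.
  apply: contrapT => /forallNP nsat; apply: H; split=> // i.
    by have := CS i; have := nsat i; rewrite /saturated; lia.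
  by have := CL i; have := nsat i; rewrite /saturated; lia.
move=> [_ CS CL]; case: H => j.
by have := CS j; have := CL j; rewrite /saturated; lia.
Qed.

Lemma seq_int_bound (s : seq int) :
  exists M : int, forall x, x \in s -> - M < x < M.
Proof.
elim: s => [|y s [M HM]]; first by exists 0.
exists (`|M| + `|y| + 1) => x; rewrite inE => /orP[/eqP -> | /HM]; lia.
Qed.

Lemma config_bound (a : config) :
  exists M : int, forall m : int, ~~ (- M < m < M) -> a m = 0%N.
Proof.
have [M HM] := seq_int_bound (finsupp a).
exists M => m nm; apply: fsfun_dflt; apply: contra nm; exact: HM.
Qed.

Lemma exists_largest (P : int -> Prop) (j M : int) :
  P j -> (forall m : int, M <= m -> ~ P m) -> exists i, is_largest P i.
Proof.
move=> Pj PM.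
have [n] : exists n : nat, M - j <= n%:Z by exists `|M - j|%N; lia.
elim: n j Pj => [|n IH] j Pj Hn; first by case: (PM j _ Pj); lia.
have [[j' [Pj' jj']]|nex] := pselect (exists j', P j' /\ j < j').
  by apply: (IH _ Pj'); lia.
exists j; split=> // j' Pj'; rewrite leNgt; apply/negP => lt.
by apply: nex; exists j'.
Qed.

Lemma largest_uniq (P : int -> Prop) i j :
  is_largest P i -> is_largest P j -> i = j.
Proof. by move=> [Pi Hi] [Pj Hj]; have := Hi _ Pj; have := Hj _ Pi; lia. Qed.

Lemma move_colP k l a : (0 < l)%N -> inCunder k l a ->
  is_largest (saturated k l a) (move_col k l a).
Proof.
move=> l0 /(inCunderP _ _ l0)[_ [j sj]].
have [M HM] := config_bound a.
have [i Hi] : exists i, is_largest (saturated k l a) i.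
  apply: (exists_largest (M := `|M| + 2) sj) => m Mm.
  by rewrite /saturated /S_ /L_ !HM; lia.
exact: (@xgetPex _ 0 [set i | is_largest (saturated k l a) i]%classic
  (ex_intro _ i Hi)).
Qed.

Lemma move_colE k l a i :
  is_largest (saturated k l a) i -> move_col k l a = i.
Proof.
move=> Hi; apply: largest_uniq (Hi).
exact: (@xgetPex _ 0 [set i | is_largest (saturated k l a) i]%classic
  (ex_intro _ i Hi)).
Qed.

Section RightMove.
Variables (k l : nat) (a : config) (i : int).
Hypotheses (l0 : (0 < l)%N) (Ca : inC k l a)
  (Hi : is_largest (saturated k l a) i).

Lemma unsaturated (m : int) : i < m -> (S_ a m < l)%N /\ (L_ a m < k + l)%N.
Proof.
clear l0; case: Ca Hi => _ CS CL [_ Hmax] im.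
have := CS m; have := CL m.
have : ~ saturated k l a m by move=> /Hmax; lia.
by rewrite /saturated; lia.
Qed.

(** If column [i] is empty, then its saturation entails that of column
    [i + 1], so [i] is not the last saturated column. *)
Lemma largest_gt0 : (0 < a i)%N.
Proof.
case: Ca Hi => Ck _ _ [].
have [] := @unsaturated (i + 1); first by lia.
have := Ck (i - 1); rewrite /saturated /S_ /L_.
by shift_columns i; lia.
Qed.

Lemma hop_inCunder b : hop a b i -> inCunder k l b.
Proof.
move=> H; apply/inCunderP => //; split; last first.
  by exists i; apply/(hop_saturated k l H); case: Hi.
case: (Ca) => Ck CS CL.
have [S1 L1] := @unsaturated (i + 1) ltac:(lia).
have [S2 L2] := @unsaturated (i + 2) ltac:(lia).
(* If the triple starting at i + 1 were full, then L_{i+1} < k + l would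
   leave less than l for the triple starting at i, and column i could not be
   saturated. *)
have T1 : (triple a (i + 1) < k)%N.
  have := Ck (i - 1); have := Ck (i + 1); case: Hi => + _; move: L1 S1.
  by rewrite /saturated /S_ /L_ /triple; shift_columns i; lia.
split=> m.
- have := hop_triple m H; have := Ck m.
  have : m = i + 1 -> (triple a m < k)%N by move=> ->.
  by rewrite /triple; lia.
- have := hop_S m H; have := CS m.
  have : m = i + 1 -> (S_ a m < l)%N by move=> ->.
  by lia.
- have := hop_L m H; have := CL m.
  have : m = i + 1 -> (L_ a m < k + l)%N by move=> ->.
  have : m = i + 2 -> (L_ a m < k + l)%N by move=> ->.
  by lia.
Qed.

End RightMove.

Lemma Mplus_hop k l a : (0 < l)%N -> inCunder k l a ->
  hop a (Mplus k l a) (move_col k l a).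
Proof.
move=> l0 Ca; have Hi := move_colP l0 Ca.
have := largest_gt0 l0 Ca.1 Hi; set i := move_col k l a => ai m.
rewrite /Mplus -/i !fsfun_withE.
have [->|_] := eqVneq m i; first by lia.
by have [->|_] := eqVneq m (i + 1); lia.
Qed.

Lemma Mplus_inCunder k l a : (0 < l)%N -> inCunder k l a ->
  inCunder k l (Mplus k l a).
Proof.
move=> l0 Ca; exact: (hop_inCunder l0 Ca.1 (move_colP l0 Ca) (Mplus_hop l0 Ca)).
Qed.

Lemma iter_Mplus_inCunder k l a t : (0 < l)%N -> inCunder k l a ->
  inCunder k l (iter t (Mplus k l) a).
Proof. by move=> l0 Ca; elim: t => //= t; exact: Mplus_inCunder. Qed.

(** Two moves with the same result take place in the same column: if [a'] moved
    further to the right than [a], then column [i'] became saturated by the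
    move of [a], so it is [i + 1] or [i + 2]; then the bounds of [a'] at [i] and
    [i + 1] cannot hold together with those of the common result. *)
Lemma hop_largest_inj k l a a' c i i' :
  (0 < l)%N -> inC k l a -> inC k l a' ->
  is_largest (saturated k l a) i -> is_largest (saturated k l a') i' ->
  hop a c i -> hop a' c i' -> i' <= i.
Proof.
move=> l0 Ca Ca' Hi Hi' H H'; rewrite leNgt; apply/negP => lt.
have [[_ CcS _] _] := hop_inCunder l0 Ca Hi H.
have [S1 L1] := unsaturated Ca Hi lt.
have si : saturated k l c i by apply/(hop_saturated k l H); case: Hi.
have si' : saturated k l c i' by apply/(hop_saturated k l H'); case: Hi'.
have : i' = i + 1 \/ i' = i + 2.
  move: si'; have := hop_S i' H; have := hop_L i' H.
  by rewrite /saturated; lia.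
case: Ca' => C3 CS CL.
case=> e; subst i'.
  move: si; have := hop_S i H'; have := hop_L i H'; have := CS i; have := CL i.
  by rewrite /saturated; lia.
(* Column i + 2 can only have been saturated through L, which leaves more
   than l in the columns i + 3 and i + 4. *)
move: si si'; have := hop_S i H'; have := hop_L i H'; have := CS i.
have := CL i; have := CL (i + 1); have := CcS (i + 3).
have := hop_L (i + 1) H'; have := hop_S (i + 2) H; move: S1.
by rewrite /saturated /S_ /L_; shift_columns i; lia.
Qed.

Lemma Mplus_inj k l a a' : (0 < l)%N -> inCunder k l a -> inCunder k l a' ->
  Mplus k l a = Mplus k l a' -> a = a'.
Proof.
move=> l0 Ca Ca' E.
have Hi := move_colP l0 Ca; have Hi' := move_colP l0 Ca'.
have H := Mplus_hop l0 Ca; have H' := Mplus_hop l0 Ca'.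
rewrite -E in H'.
have Ei : move_col k l a = move_col k l a'.
  have := hop_largest_inj l0 Ca.1 Ca'.1 Hi Hi' H H'.
  have := hop_largest_inj l0 Ca'.1 Ca.1 Hi' Hi H' H.
  by lia.
apply/fsfunP => m; have := H m; have := H' m; rewrite Ei; lia.
Qed.

Lemma iter_Mplus_inj k l a a' t : (0 < l)%N -> inCunder k l a ->
  inCunder k l a' -> iter t (Mplus k l) a = iter t (Mplus k l) a' -> a = a'.
Proof.
move=> l0 Ca Ca'; elim: t => //= t IH /Mplus_inj E; apply: IH.
by apply: E => //; exact: iter_Mplus_inCunder.
Qed.

(** * Walls, free particles and the existence of riggings *)

Definition in_window (N : int) (n : nat) (a : config) : Prop :=
  forall m : int, ~~ (N - n%:Z < m <= N) -> a m = 0%N.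

Definition weighted_sum (f : nat -> nat) (N : int) (n : nat) (a : config) :=
  (\sum_(j < n) f j * a (N - j%:Z)%R)%N.

Lemma sum_delta (f : nat -> nat) n p : (p < n)%N ->
  (\sum_(j < n) f j * (j == p :> nat))%N = f p.
Proof.
move=> pn; rewrite (bigD1 (Ordinal pn)) //= eqxx muln1 big1 ?addn0 // => j.
by rewrite -val_eqE /= => /negbTE ->; rewrite muln0.
Qed.

Lemma hop_weighted_sum f (N : int) n a b p : hop a b (N - p.+1%:Z) -> (p.+1 < n)%N ->
  (weighted_sum f N n b + f p.+1 = weighted_sum f N n a + f p)%N.
Proof.
move=> H pn; rewrite -(sum_delta f pn) -(sum_delta f (ltnW pn)).
rewrite /weighted_sum -!big_split; apply: eq_bigr => j _ /=.
rewrite -!mulnDr; congr (_ * _)%N; have := H (N - j%:Z).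
lia.
Qed.

Lemma hop_in_window (N : int) n a b i : hop a b i -> (0 < a i)%N -> i + 1 <= N ->
  in_window N n a -> in_window N n b.
Proof.
move=> H ai iN Wa m nm; have := H m; rewrite Wa //.
have : N - n%:Z < i by rewrite ltNge; apply/negP => ?; move: ai; rewrite Wa; lia.
lia.
Qed.

(** In column [N] a configuration without entries beyond can be saturated only
    by [a_N = l]: the other condition, [a_{N-1} + 2 a_N = k + l], forces the
    same since [a_{N-1} + a_N <= l <= k]. *)
Lemma move_at_wall k l a i (N : int) : (0 < l <= k)%N -> inC k l a ->
  is_largest (saturated k l a) i -> (forall m : int, N < m -> a m = 0%N) ->
  i + 1 <= N \/ a N = l /\ a (N - 1) = 0%N.
Proof.
move=> /andP[l0 lk] Ca Hi aN; have ai := largest_gt0 l0 Ca Hi.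
have [iN|iN] := leP (i + 1) N; [by left | right].
have E : N = i by have [?|] := ltP N i; [move: ai; rewrite aN | lia].
subst N; case: Ca Hi => _ CS _ [+ _]; have := CS i; have := CS (i - 1).
rewrite /saturated /S_ /L_; shift_columns i.
by rewrite (aN (i + Posz 1)) ?(aN (i + Posz 2)); lia.
Qed.

(** As long as the right move stays within the columns up to [N] it can be
    repeated, and it lowers the potential [sum of (N - i) a_i] by one; so it
    must end in the configuration described by [move_at_wall].  The window keeps
    the potential a finite sum, and the plain sum of the entries is recorded
    because it is what decreases when the particle is removed. *)
Lemma reach_wall k l (N : int) n a : (0 < l <= k)%N -> inCunder k l a ->
  in_window N n a ->
  exists t, let b := iter t (Mplus k l) a in
    [/\ in_window N n b, b N = l, b (N - 1) = 0%N &
        weighted_sum (fun=> 1%N) N n b = weighted_sum (fun=> 1%N) N n a].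
Proof.
move=> lk; have /andP[l0 _] := lk.
have [w] : exists w, (weighted_sum id N n a <= w)%N.
  by exists (weighted_sum id N n a).
elim: w a => [|w IH] a Hw Ca Wa.
all: have Hi := move_colP l0 Ca; have ai := largest_gt0 l0 Ca.1 Hi.
all: have H := Mplus_hop l0 Ca.
all: have aN (m : int) : N < m -> a m = 0%N by move=> ?; apply: Wa; lia.
all: have [iN|[]] := move_at_wall lk Ca.1 Hi aN; last by exists 0%N.
all: set i := move_col k l a in Hi ai H iN.
all: have ni : N - n%:Z < i
  by rewrite ltNge; apply/negP => ?; move: ai; rewrite Wa; lia.
all: have [p Ep] : exists p : nat, i = N - p.+1%:Z
  by exists (absz (N - i - 1)%R); lia.
all: rewrite Ep in H; have pn : (p.+1 < n)%N by lia.
  by have /= := hop_weighted_sum id H pn; lia.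
have := IH _ _ (Mplus_inCunder l0 Ca).
rewrite Ep in ai iN.
case.
- by have /= := hop_weighted_sum id H pn; lia.
- exact: hop_in_window H ai iN Wa.
move=> t; rewrite /= -iterSr => -[? ? ? E]; exists t.+1; split=> //.
by rewrite E; have /= := hop_weighted_sum (fun=> 1%N) H pn; lia.
Qed.

Lemma remove_particleE a i m :
  remove_particle a i m = if (m == i) || (m == i + 1) then 0%N else a m.
Proof.
rewrite /remove_particle !fsfun_withE.
by case: eqVneq => //= _; case: eqVneq.
Qed.

Lemma free_step k l b i : (0 < l <= k)%N -> inCunder k l b ->
  free_particle l b i ->
  exists i', [/\ free_particle l (Mplus k l b) i',
    particle_energy l (Mplus k l b) i' = particle_energy l b i + 1 &
    remove_particle (Mplus k l b) i' = remove_particle b i].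
Proof.
move=> /andP[l0 lk] Cb [Sb bi b0].
have Ei : move_col k l b = i.
  apply: move_colE; split; first by left.
  move=> j sj; rewrite leNgt; apply/negP => ij; move: sj.
  have : j = i + 1 \/ j = i + 2 \/ i + 3 <= j by lia.
  move: Sb => + [->|[->|ij3]]; rewrite /saturated /S_ /L_; shift_columns i.
  - by rewrite (b0 (i + Posz 2)) ?(b0 (i + Posz 3)); lia.
  - by rewrite (b0 (i + Posz 2)) ?(b0 (i + Posz 3)) ?(b0 (i + Posz 4)); lia.
  - by move=> _; rewrite !b0; lia.
have := Mplus_hop l0 Cb; rewrite Ei; set c := Mplus k l b => H.
have Hi := H i; have Hi1 := H (i + 1); have Hi2 := H (i + 2).
have c0 (m : int) : i + 2 <= m -> c m = 0%N by move=> im; have := H m; rewrite b0; lia.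
exists (if b i == 1%N then i + 1 else i).
have [b1|nb1] := eqVneq (b i) 1%N.
- split.
  + split; last by move=> j ij; apply: c0; lia.
      by rewrite (c0 (i + 1 + 1)); lia.
    by lia.
  + rewrite /particle_energy; have : c (i + 1) = l by lia.
    by move=> ->; nia.
  + apply/fsfunP => m; rewrite !remove_particleE.
    have [->|mi] := eqVneq m i.
      by rewrite /= (_ : c i = 0%N) ?if_same //; lia.
    have [->|mi1] := eqVneq m (i + 1); first by [].
    have [->|mi2] := eqVneq m (i + 1 + 1); last by have := H m; rewrite orbF; lia.
    by rewrite orbF /= b0; lia.
- split.
  + by split=> //; lia.
  + by rewrite /particle_energy; nia.
  + apply/fsfunP => m; rewrite !remove_particleE.
    by case: ifP => // nm; have := H m; lia.
Qed.

(** By [free_step], one time at which the particle is free already determines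
    the outcome of the peeling. *)
Lemma free_peels_to k l a t i : (0 < l <= k)%N -> inCunder k l a ->
  free_particle l (iter t (Mplus k l) a) i ->
  peels_to k l a (particle_energy l (iter t (Mplus k l) a) i - t%:Z)
    (remove_particle (iter t (Mplus k l) a) i).
Proof.
move=> lk Ca Hf; exists t => t'; have /andP[l0 _] := lk.
elim: t' => [|t' IH] tt'.
  have t0 : t = 0%N by lia.
  by subst t; exists i.
have [tt|tt] := leqP t t'; last first.
  have <- : t = t'.+1 by lia.
  by exists i.
have [i' [Hf' Es Er]] := IH tt.
have [i'' [Hf'' Es' Er']] :=
  free_step lk (iter_Mplus_inCunder t' l0 Ca) Hf'.
exists i''; split=> //=; first by rewrite Es' Es; lia.
by rewrite Er' Er.
Qed.

Lemma wall_free l (b : config) (N : int) : (0 < l)%N -> b N = l ->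
  (forall m : int, N < m -> b m = 0%N) -> free_particle l b N.
Proof.
move=> l0 bN b0; split; [by rewrite bN b0; lia | by lia |].
by move=> j Nj; apply: b0; lia.
Qed.

Lemma wall_energy l (b : config) (N : int) : b N = l ->
  particle_energy l b N = l%:Z * N.
Proof. by rewrite /particle_energy => ->; nia. Qed.

Lemma inCk_remove k a i : inCk k a -> inCk k (remove_particle a i).
Proof.
move=> C m; have := C m; rewrite !remove_particleE.
by do 3!case: ifP => _; lia.
Qed.

Lemma inC_remove k l a i : inC k l a -> inC k l (remove_particle a i).
Proof.
move=> [Ck CS CL]; split; first exact: inCk_remove.
- move=> m; have := CS m; rewrite /S_ !remove_particleE.
  by do 2!case: ifP => _; lia.
- move=> m; have := CL m; rewrite /L_ !remove_particleE.
  by do 4!case: ifP => _; lia.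
Qed.

Lemma inCk_inC k a : inCk k a -> inC k k a.
Proof.
move=> C; split=> // m; first by have := C m; rewrite /S_; lia.
by have := C m; have := C (m - 1); rewrite /L_; shift_columns m; lia.
Qed.

Lemma inC0 k a : inC k 0 a -> a = zero_config.
Proof.
by move=> [_ CS _]; apply/fsfunP => m; have := CS m; rewrite /S_ fsfun0E; lia.
Qed.

Lemma inCk_level k a : inCk k a ->
  a = zero_config \/ exists2 l, (0 < l <= k)%N & inCunder k l a.
Proof.
move=> Ca; have ex : exists l, `[< inC k l a >].
  by exists k; apply/asboolP; exact: inCk_inC.
case: (ex_minnP ex) => -[|l] /asboolP Cl lmin; first by left; apply: inC0 Cl.
right; exists l.+1; first by apply: lmin; apply/asboolP; exact: inCk_inC.
by split=> //= /asboolP /lmin; rewrite ltnn.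
Qed.

(** Induction on the sum of the entries within a fixed window of columns: the
    right moves preserve it and the removal of a particle lowers it. *)
Lemma iota_total k a : inCk k a -> exists p, iota_graph k a p.
Proof.
have [M HM] := config_bound a; pose n := absz (M + M)%R.
have : in_window M n a by move=> m ?; apply: HM; lia.
clear HM; have [w] : exists w, (weighted_sum (fun=> 1%N) M n a <= w)%N.
  by exists (weighted_sum (fun=> 1%N) M n a).
elim: w a => [|w IH] a Hw Wa Ca.
all: have [->|[l lk Cla]] := inCk_level Ca;
  first by exists ([::], [::]); exact: iota_zero.
all: have [t /= [Wb bN _ Ew]] := reach_wall lk Cla Wa; have /andP[l0 _] := lk.
all: set b := iter _ _ _ in Wb bN Ew.
all: have n0 : (0 < n)%N by rewrite lt0n; apply/negP => /eqP n0;
  move: bN; rewrite Wb; lia.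
all: have En : n = n.-1.+1 by lia.
  move: Hw; rewrite -Ew /weighted_sum En big_ord_recl /= subr0 bN; lia.
have Hf : free_particle l b M.
  by apply: wall_free => // m ?; apply: Wb; lia.
have [[lam rho] Hp] : exists p, iota_graph k (remove_particle b M) p.
  apply: IH.
  - move: Hw; rewrite -Ew /weighted_sum En !big_ord_recl /= !subr0 bN.
    rewrite remove_particleE eqxx /=.
    rewrite [X in _ -> (_ + X <= w)%N](eq_bigr
      (fun i : 'I_n.-1 => 1 * b (M - (bump 0 i)%:Z)%R)%N); first lia.
    move=> i _; rewrite remove_particleE; case: ifP => //.
    by rewrite /bump /=; lia.
  - by move=> m nm; rewrite remove_particleE Wb //; case: ifP.
  - by apply: inCk_remove; case: (iter_Mplus_inCunder t l0 Cla) => -[].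
exists (l :: lam, (particle_energy l b M - t%:Z
  - (\sum_(m <- lam) A_ k l m)%N%:Z) :: rho).
exact: iota_cons lk Cla (free_peels_to lk Cla Hf) Hp.
Qed.

(** * A particle crossing a configuration *)

(** Let a particle of weight [l] travel from far right to far left through [a],
    by moves inverse to the right move.  All its units pass a given pair of
    columns before any unit passes the next pair, and [c m] is the number of
    units that go from column [m + 2] to column [m + 1].  They go until one of
    the bounds of [C^(k,l)] at the columns ahead is attained, so
    [c m = min (l - S_m) (k + l - L_m - c (m + 1)) (k + l - L_{m-1})]; the last
    bound keeps [c (m - 1)] nonnegative.  The fields spell out this minimum. *)
Record carrier (k l : nat) (a : config) (c : int -> nat) : Prop := Carrier {
  carrier_S : forall m : int, (c m + S_ a m <= l)%N;
  carrier_L : forall m : int, (c m + c (m + 1)%R + L_ a m <= k + l)%N;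
  carrier_L1 : forall m : int, (c m + L_ a (m - 1)%R <= k + l)%N;
  carrier_max : forall m : int, (c m + S_ a m = l)%N \/
    (c m + c (m + 1)%R + L_ a m = k + l)%N \/
    (c m + L_ a (m - 1)%R = k + l)%N;
  carrier_right : exists M : int, forall m : int, M <= m -> c m = l }.

(** [b] is what the travelling particle leaves behind: column [m] receives
    [c (m - 1)] units and loses [c (m - 2)].  As a consequence the particles of
    [a] are displaced to the right. *)
Definition passes (a b : config) (c : int -> nat) : Prop :=
  forall m : int, (b m + c (m - 2)%R)%N = (a m + c (m - 1)%R)%N.

Lemma int_down_ind (P : int -> Prop) (M : int) :
  (forall m : int, M <= m -> P m) ->
  (forall m : int, P (m + 1) -> P (m + 2) -> P m) -> forall m : int, P m.
Proof.
move=> PM Pstep m.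
suff H (n : nat) : P (M - n%:Z) /\ P (M - n%:Z + 1).
  have [/PM //|mM] := leP M m.
  have -> : m = M - (absz (M - m)%R)%:Z by lia.
  by case: (H (absz (M - m)%R)).
elim: n => [|n [IH1 IH2]]; first by split; apply: PM; lia.
have E : M - n.+1%:Z + 1 = M - n%:Z by lia.
rewrite E; split=> //; apply: Pstep; first by rewrite E.
by have -> : M - n.+1%:Z + 2 = M - n%:Z + 1 by lia.
Qed.

(** The recursion runs leftwards, so it depends on the columns to the right only
    through one value. *)
Lemma carrier_agree k l a a' c c' (X : int) :
  carrier k l a c -> carrier k l a' c' ->
  (forall m : int, m < X -> S_ a m = S_ a' m) ->
  (forall m : int, m < X -> L_ a m = L_ a' m) ->
  c X = c' X -> forall m : int, m <= X -> c m = c' m.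
Proof.
move=> Hc Hc' ES EL EX m mX.
have -> : m = X - (absz (X - m)%R)%:Z by lia.
elim: (absz _) => [|n IH]; first by rewrite subr0.
have En : X - n.+1%:Z + 1 = X - n%:Z by lia.
have := carrier_max Hc (X - n.+1%:Z); have := carrier_max Hc' (X - n.+1%:Z).
have := carrier_S Hc (X - n.+1%:Z); have := carrier_S Hc' (X - n.+1%:Z).
have := carrier_L Hc (X - n.+1%:Z); have := carrier_L Hc' (X - n.+1%:Z).
have := carrier_L1 Hc (X - n.+1%:Z); have := carrier_L1 Hc' (X - n.+1%:Z).
rewrite En IH !ES ?EL; [|lia..].
lia.
Qed.

Lemma carrier_exists k l a : (l <= k)%N -> inC k l a ->
  exists c, carrier k l a c.
Proof.
move=> lk [_ CS CL]; have [M0 HM0] := config_bound a; pose M := `|M0| + 3.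
have S0 m : M <= m + 2 -> S_ a m = 0%N by move=> ?; rewrite /S_ !HM0; lia.
have L0 m : M <= m + 1 -> L_ a m = 0%N by move=> ?; rewrite /L_ !HM0; lia.
pose fix cn (n : nat) : nat := if n is n'.+1 then
  minn (l - S_ a (M - n%:Z)%R) (minn (k + l - L_ a (M - n%:Z)%R - cn n')
    (k + l - L_ a (M - n%:Z - 1)%R))%N else l.
have cnL n : (cn n + L_ a (M - n%:Z - 1)%R <= k + l)%N.
  case: n => [|n] /=; first by rewrite L0; lia.
  by have := CL (M - n.+1%:Z - 1); lia.
pose c m := if M <= m then l else cn (absz (M - m)%R).
have cM m : M <= m -> c m = l by rewrite /c => ->.
have cE n : c (M - n%:Z) = cn n.
  case: n => [|n]; first by rewrite cM ?subr0.
  rewrite /c ifF; last by lia.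
  by congr cn; lia.
have split_col m : M <= m \/ exists n : nat, m = M - n.+1%:Z.
  have [?|?] := leP M m; [by left | right].
  by exists (absz (M - m - 1)%R); lia.
have facts m : [/\ (c m + S_ a m <= l)%N, (c m + c (m + 1)%R + L_ a m <= k + l)%N,
    (c m + L_ a (m - 1)%R <= k + l)%N & (c m + S_ a m = l)%N \/
    (c m + c (m + 1)%R + L_ a m = k + l)%N \/
    (c m + L_ a (m - 1)%R = k + l)%N].
  have [Mm|[n ->]] := split_col m.
    by rewrite !cM ?S0 ?L0; [split|..]; lia.
  have -> : M - n.+1%:Z + 1 = M - n%:Z by lia.
  rewrite !cE; have := cnL n; have := cnL n.+1.
  have := CS (M - n.+1%:Z); have := CL (M - n.+1%:Z - 1).
  have -> : M - n%:Z - 1 = M - n.+1%:Z by lia.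
  move=> /=; set x := minn _ _; have : (x = minn (l - S_ a (M - n.+1%:Z)%R)
    (minn (k + l - L_ a (M - n.+1%:Z)%R - cn n)
    (k + l - L_ a (M - n.+1%:Z - 1)%R)))%N by [].
  by clearbody x => *; split; lia.
by exists c; split; [move=> m; case: (facts m)..|exists M].
Qed.

Section Carrier.
Variables (k l : nat) (a : config) (c : int -> nat).
Hypotheses (lk : (l <= k)%N) (Ca : inC k l a) (Hc : carrier k l a c).

(** The intermediate configurations of the crossing satisfy the bound on three
    consecutive columns.  The recursion controls only [S] and [L]; that this
    third bound comes for free is the reason why the result of a crossing is
    again admissible.  If [c (m + 1)] is given by its first or last bound, then
    the bound on [c m + c (m + 1)] suffices; otherwise that bound reduces the
    claim to the same one at [m + 2]. *)
Lemma carrier_triple (m : int) : (c m + triple a (m - 1) <= k)%N.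
Proof.
have [M HM] := carrier_right Hc; have [M' HM'] := config_bound a.
move: m; apply: (int_down_ind (M := `|M| + `|M'| + 1)) => m.
  by move=> ?; rewrite HM /triple ?HM'; lia.
move=> _; case: Ca => Ck _ _; have := Ck (m - 1); have := carrier_L Hc m.
have := carrier_max Hc (m + 1).
by rewrite /triple /S_ /L_; shift_columns m; lia.
Qed.

(** That is, the entries left behind by the crossing are nonnegative. *)
Lemma carrier_out (m : int) : (c m <= a (m + 2)%R + c (m + 1)%R)%N.
Proof.
have := carrier_triple m; have := carrier_triple (m + 2).
have := carrier_S Hc m; have := carrier_max Hc (m + 1).
by rewrite /triple /S_ /L_; shift_columns m; lia.
Qed.

End Carrier.

Lemma config_of_fun (f : int -> nat) (M : int) :
  (forall m : int, ~~ (- M < m < M) -> f m = 0%N) ->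
  exists a : config, forall m : int, a m = f m.
Proof.
move=> fM; pose s := [seq i%:Z - `|M| | i <- iota 0 (absz (M + M)%R)].
exists [fsfun z in [fset z | z in s]%fset => f z | 0%N] => m.
rewrite fsfunE; case: ifP => // /negbT; rewrite in_fset /= => ns.
rewrite fM //; apply: contra ns => mM; apply/mapP.
exists (absz (m + `|M|)%R); last by lia.
by rewrite mem_iota; lia.
Qed.

Lemma passes_exists k l a c : (l <= k)%N -> inC k l a -> carrier k l a c ->
  exists b, passes a b c.
Proof.
move=> lk Ca Hc; have [M HM] := carrier_right Hc.
have [M' HM'] := config_bound a.
have cl (m : int) : m < - `|M'| - 3 -> c m = l.
  have := carrier_max Hc m; have := carrier_S Hc m; have := carrier_S Hc (m + 1).
  by move=> + + + ?; rewrite /S_ /L_ !HM'; lia.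
have [|b Hb] := @config_of_fun (fun m => a m + c (m - 1)%R - c (m - 2)%R)%N
  (`|M| + `|M'| + 6).
  move=> m nm; have [?|?] := leP 0 m; first by rewrite !HM ?HM'; lia.
  by rewrite !cl ?HM'; lia.
exists b => m; rewrite Hb; have := carrier_out lk Ca Hc (m - 2).
have -> : m - 2 + 2 = m by lia.
have -> : m - 2 + 1 = m - 1 by lia.
lia.
Qed.

Section Passing.
Variables (k l : nat) (a b : config) (c : int -> nat).
Hypothesis (Hb : passes a b c).

Lemma passes_S (m : int) : (S_ b m + c (m - 2)%R = S_ a m + c m)%N.
Proof.
have := Hb m; have := Hb (m + 1).
by rewrite /S_; shift_columns m; lia.
Qed.

Lemma passes_triple (m : int) :
  (triple b m + c (m - 2)%R = triple a m + c (m + 1)%R)%N.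
Proof.
have := Hb m; have := Hb (m + 1); have := Hb (m + 2).
by rewrite /triple; shift_columns m; lia.
Qed.

Lemma passes_L (m : int) :
  (L_ b m + c (m - 3)%R + c (m - 2)%R = L_ a m + c m + c (m + 1)%R)%N.
Proof.
have := passes_S (m - 1); have := passes_S m; have := passes_S (m + 1).
have := L_S a (m - 1); have := L_S b (m - 1).
by shift_columns m; lia.
Qed.

Hypothesis (Hc : carrier k l a c).

(** A crossing does not raise the level, and the level of the result at column
    [m] is controlled by that of [a] two to four columns to the left.  This
    locality is used again to locate the last saturated column of the result. *)
Lemma passes_S_le n (m : int) : (S_ a (m - 3) <= n)%N -> (L_ a (m - 3) <= k + n)%N ->
  (S_ a (m - 2) <= n)%N -> (S_ b m <= n)%N.
Proof.
have := passes_S m; have := carrier_max Hc (m - 2).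
have := carrier_L Hc (m - 1); have := carrier_S Hc m.
have := L_S a (m - 2); have := L_S a (m - 3).
have := L_S a (m - 4); by shift_columns m; lia.
Qed.

Lemma passes_L_le n (m : int) : (L_ a (m - 4) <= k + n)%N -> (S_ a (m - 3) <= n)%N ->
  (L_ a (m - 3) <= k + n)%N -> (L_ b m <= k + n)%N.
Proof.
have := passes_L m; have := carrier_max Hc (m - 3); have := carrier_L Hc m.
by shift_columns m; lia.
Qed.

Hypotheses (lk : (l <= k)%N) (Ca : inC k l a).

Lemma passes_inC n : inC k n a -> inC k n b.
Proof.
move=> [_ CS CL]; case: (Ca) => Ck _ _; split=> m.
- have := passes_triple m; have := carrier_triple lk Ca Hc (m + 1).
  have -> : m + 1 - 1 = m by lia.
  by have := Ck m; rewrite /triple; lia.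
- exact: passes_S_le.
- exact: passes_L_le.
Qed.

End Passing.

(** * The crossing and a single right move *)

(** Let [a'] be obtained from [a], of level [n <= l], by the right move, in
    column [i].  The hop lowers by one the bounds [l - S_{i+1}],
    [k + l - L_{i+1}] and [k + l - L_{i+2}] on the carrier, and raises by one
    the corresponding bounds at [i - 1] and [i - 2].  Reading from the right,
    the first carrier entry for which a lowered bound was attained gives way by
    one.  This is compensated at once in the recursion, and nothing else changes
    until column [i - 1], all of whose bounds have gone up.  So the carrier loses
    one unit at some [j - 1] and gains one at [i - 1], which says that the
    result of the crossing makes a hop in column [j].  It remains to see that
    [j] is the column of the right move of the result.  Which of [i + 2],
    [i + 3], [i + 4] is [j] depends on the bounds attained at [i + 2] and
    [i + 3]. *)
Section Commute.
Variables (k l n : nat) (a a' b : config) (c : int -> nat) (i : int).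

Definition shifted_carrier (j m : int) : nat :=
  (c m + (m == i - 1)%R - (m == j - 1)%R)%N.

Definition carrier_at (a : config) (c : int -> nat) (m : int) : Prop :=
  [/\ (c m + S_ a m <= l)%N, (c m + c (m + 1)%R + L_ a m <= k + l)%N,
    (c m + L_ a (m - 1)%R <= k + l)%N & (c m + S_ a m = l)%N \/
    (c m + c (m + 1)%R + L_ a m = k + l)%N \/
    (c m + L_ a (m - 1)%R = k + l)%N].

Lemma shifted_carrierE (j m : int) : i + 2 <= j -> (0 < c (j - 1))%N ->
  (shifted_carrier j m + (m == j - 1)%R = c m + (m == i - 1)%R)%N.
Proof.
move=> ij cj; rewrite /shifted_carrier.
by have [->|] := eqVneq m (j - 1); lia.
Qed.

Lemma shifted_carrier_id (j m : int) : m != i - 1 -> m != j - 1 ->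
  shifted_carrier j m = c m.
Proof. by rewrite /shifted_carrier => /negbTE -> /negbTE ->; rewrite addn0 subn0. Qed.

Hypothesis Haa' : hop a a' i.

Lemma hop_S_id (m : int) : m != i - 1 -> m != i + 1 -> S_ a' m = S_ a m.
Proof. by have := hop_S m Haa' => + /negbTE E1 /negbTE E2; rewrite E1 E2 !addn0. Qed.

Lemma hop_L_id (m : int) : m != i - 2 -> m != i - 1 -> m != i + 1 -> m != i + 2 ->
  L_ a' m = L_ a m.
Proof.
have := hop_L m Haa' => + /negbTE E1 /negbTE E2 /negbTE E3 /negbTE E4.
by rewrite E1 E2 E3 E4 !addn0.
Qed.

Lemma hop_S_near : [/\ S_ a' i = S_ a i, S_ a' (i + 1) = (S_ a (i + 1)).+1,
  S_ a' (i + 2) = S_ a (i + 2) & S_ a' (i + 3) = S_ a (i + 3)].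
Proof.
by split; [apply: hop_S_id| |apply: hop_S_id..]; try lia;
  have := hop_S (i + 1) Haa'; rewrite eqxx; lia.
Qed.

Lemma hop_L_near : [/\ (L_ a' (i - 1)).+1 = L_ a (i - 1), L_ a' i = L_ a i,
  L_ a' (i + 1) = (L_ a (i + 1)).+1, L_ a' (i + 2) = (L_ a (i + 2)).+1 &
  L_ a' (i + 3) = L_ a (i + 3)].
Proof.
split; try (by apply: hop_L_id; lia).
- by have := hop_L (i - 1) Haa'; rewrite eqxx; lia.
- by have := hop_L (i + 1) Haa'; rewrite eqxx; lia.
- by have := hop_L (i + 2) Haa'; rewrite eqxx; lia.
Qed.

Hypothesis Hb : passes a b c.

Lemma passes_hop (j : int) b' : i + 2 <= j -> (0 < c (j - 1))%N -> hop b b' j ->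
  passes a' b' (shifted_carrier j).
Proof.
move=> ij cj Hbb' m; have := Hb m; have := Haa' m; have := Hbb' m.
have := shifted_carrierE (m - 1) ij cj.
have := shifted_carrierE (m - 2) ij cj.
lia.
Qed.

Hypothesis Hc : carrier k l a c.

(** Outside the four columns [i .. i + 3] the new carrier inherits the recursion
    from the old one, the changes at [i - 2] and [i - 1] cancelling. *)
Lemma shifted_carrierP (j : int) : i + 2 <= j <= i + 4 -> (0 < c (j - 1))%N ->
  (forall m : int, i <= m <= i + 3 -> carrier_at a' (shifted_carrier j) m) ->
  carrier k l a' (shifted_carrier j).
Proof.
move=> /andP[ij ji] cj Hloc.
have H (m : int) : carrier_at a' (shifted_carrier j) m.
  have [?|nm] := boolP (i <= m <= i + 3); first exact: Hloc.
  have c_i : shifted_carrier j (i - 1) = (c (i - 1)).+1.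
    by rewrite /shifted_carrier eqxx; lia.
  have Si : (S_ a' (i - 1)).+1 = S_ a (i - 1).
    by have := hop_S (i - 1) Haa'; rewrite eqxx; lia.
  have Li : (L_ a' (i - 1)).+1 = L_ a (i - 1).
    by have := hop_L (i - 1) Haa'; rewrite eqxx; lia.
  have Li2 : (L_ a' (i - 2)).+1 = L_ a (i - 2).
    by have := hop_L (i - 2) Haa'; rewrite eqxx; lia.
  have := carrier_S Hc m; have := carrier_L Hc m; have := carrier_L1 Hc m.
  have := carrier_max Hc m; rewrite /carrier_at.
  have [->|m1] := eqVneq m (i - 1).
    have -> : i - 1 + 1 = i by lia.
    have -> : i - 1 - 1 = i - 2 by lia.
    rewrite c_i (shifted_carrier_id (m := i)); [|lia..].
    by clear -Si Li Li2; move=> *; split; lia.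
  have [->|m2] := eqVneq m (i - 2).
    have -> : i - 2 + 1 = i - 1 by lia.
    rewrite c_i (shifted_carrier_id (m := i - 2)) ?hop_S_id
      ?(hop_L_id (m := i - 2 - 1)); [|lia..].
    by clear -Si Li Li2; move=> *; split; lia.
  by rewrite !shifted_carrier_id ?hop_S_id ?hop_L_id; try lia.
split; try by [move=> m; case: (H m)].
have [M HM] := carrier_right Hc; exists (`|M| + `|i| + 5) => m mM.
by rewrite shifted_carrier_id ?HM; lia.
Qed.

Hypotheses (n0 : (0 < n)%N) (nl : (n <= l)%N).
Hypotheses (Ca : inC k n a) (Hi : is_largest (saturated k n a) i).

Lemma passes_unsaturated_S (m : int) : i + 4 <= m -> (S_ b m < n)%N.
Proof.
move=> im; have [Sm Lm] := unsaturated Ca Hi (m := m - 3) ltac:(lia).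
have [Sm' _] := unsaturated Ca Hi (m := m - 2) ltac:(lia).
suff : (S_ b m <= n.-1)%N by lia.
by apply: (passes_S_le Hb Hc); lia.
Qed.

Lemma passes_unsaturated_L (m : int) : i + 5 <= m -> (L_ b m < k + n)%N.
Proof.
move=> im; have [Sm Lm] := unsaturated Ca Hi (m := m - 3) ltac:(lia).
have [_ Lm'] := unsaturated Ca Hi (m := m - 4) ltac:(lia).
suff : (L_ b m <= k + n.-1)%N by lia.
by apply: (passes_L_le Hb Hc); lia.
Qed.

(** Far to the right of [i] the result of the crossing is unsaturated because
    [a] is, so only a few columns after [j] have to be inspected. *)
Lemma largest_after (j : int) : saturated k n b j ->
  (forall m : int, j < m -> m < i + 4 -> (S_ b m < n)%N) ->
  (forall m : int, j < m -> m < i + 5 -> (L_ b m < k + n)%N) ->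
  is_largest (saturated k n b) j.
Proof.
move=> sj HS HL; split=> // m sm; rewrite leNgt; apply/negP => jm.
have : (S_ b m < n)%N.
  by have [?|?] := ltP m (i + 4); [exact: HS | exact: passes_unsaturated_S].
have : (L_ b m < k + n)%N.
  by have [?|?] := ltP m (i + 5); [exact: HL | exact: passes_unsaturated_L].
by move: sm; rewrite /saturated; lia.
Qed.

Definition hop_lands (j : int) : Prop :=
  [/\ i + 2 <= j <= i + 4, (0 < c (j - 1))%N,
    carrier k l a' (shifted_carrier j) & is_largest (saturated k n b) j].

Lemma near_columns (m : int) : i <= m <= i + 3 ->
  m = i \/ m = i + 1 \/ m = i + 2 \/ m = i + 3.
Proof. clear; lia. Qed.

Lemma hop_lands_4 : (c (i + 3)%R + L_ a (i + 2)%R = k + l)%N ->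
  hop_lands (i + 4).
Proof.
move=> E3.
have [S1 L1] := unsaturated Ca Hi (m := i + 1) ltac:(lia).
have [S2 L2] := unsaturated Ca Hi (m := i + 2) ltac:(lia).
have s_i := Hi.1.
have c2 : c (i + 2) = 0%N.
  by have := carrier_L Hc (i + 2); move: E3; shift_columns i; lia.
have [E1 T1 V1] : [/\ (c (i + 1) + L_ a i = k + l)%N,
    (c (i + 1) + S_ a (i + 1) < l)%N & (c (i + 1) + L_ a (i + 1) < k + l)%N].
  have := carrier_L1 Hc (i + 1); have := carrier_L Hc (i + 1).
  have := carrier_max Hc (i + 1); have := carrier_S Hc (i + 3).
  have := L_S a (i - 1); have := L_S a i; have := L_S a (i + 1).
  move: E3 c2 S1 L1 L2 s_i; rewrite /saturated; clear -nl.
  by shift_columns i; move=> *; split; lia.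
have E0 : (c i + S_ a i = l)%N \/ (c i + c (i + 1) + L_ a i = k + l)%N.
  have [_ _ /(_ (i - 1))] := Ca; have := carrier_max Hc i.
  have := carrier_S Hc i; have := carrier_L Hc i.
  move: s_i; rewrite /saturated; clear -nl.
  by shift_columns i; move=> *; lia.
have cj : (0 < c (i + 4 - 1))%N.
  have -> : i + 4 - 1 = i + 3 by lia.
  by move: E3 L2; clear -nl; lia.
split=> //; first by lia.
- apply: shifted_carrierP => // [|m /near_columns Hm]; first by lia.
  have c'E m' : m' != i - 1 -> m' != i + 3 -> shifted_carrier (i + 4) m' = c m'.
    by move=> ? ?; apply: shifted_carrier_id; lia.
  have c'3 : (shifted_carrier (i + 4) (i + 3)).+1 = c (i + 3).
    by have := @shifted_carrierE (i + 4) (i + 3) ltac:(lia) cj; lia.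
  have [Sa0 Sa1 Sa2 Sa3] := hop_S_near; have [La_1 La0 La1 La2 La3] := hop_L_near.
  have := carrier_S Hc m; have := carrier_L Hc m; have := carrier_L1 Hc m.
  have := carrier_max Hc m.
  have := c'E i; have := c'E (i + 1); have := c'E (i + 2); have := c'E (i + 4).
  move: c'3 Sa0 Sa1 Sa2 Sa3 La_1 La0 La1 La2 La3 E0 E1 T1 V1 c2 E3 L1 L2 S1 S2.
  rewrite /carrier_at; clear -nl Hm.
  by case: Hm => [|[|[|]]] ->; shift_columns i; move=> *; split; lia.
- apply: largest_after; try lia.
  have := passes_S Hb (i + 4); have := passes_L Hb (i + 4).
  have := carrier_max Hc (i + 4); have := carrier_L Hc (i + 3).
  have := carrier_S Hc (i + 3).
  have := L_S a (i - 1); have := L_S a i; have := L_S a (i + 1).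
  have := L_S a (i + 2); have := L_S a (i + 3).
  move: E1 c2 E3 S1 L1 L2 s_i; rewrite /saturated; clear -nl.
  by shift_columns i; move=> *; lia.
Qed.

Lemma hop_lands_3 : (c (i + 3)%R + L_ a (i + 2)%R < k + l)%N ->
  (c (i + 2)%R + c (i + 3)%R + L_ a (i + 2)%R = k + l)%N \/
    (c (i + 2)%R + L_ a (i + 1)%R = k + l)%N ->
  hop_lands (i + 3).
Proof.
move=> E3 E2.
have [S1 L1] := unsaturated Ca Hi (m := i + 1) ltac:(lia).
have [S2 L2] := unsaturated Ca Hi (m := i + 2) ltac:(lia).
have s_i := Hi.1.
have T1 : (c (i + 1) + S_ a (i + 1) < l)%N.
  have := carrier_L1 Hc (i + 1); have := carrier_L Hc (i + 1).
  have := carrier_S Hc (i + 3).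
  have := L_S a (i - 1); have := L_S a i; have := L_S a (i + 1).
  move: E3 E2 S1 L1 L2 s_i; rewrite /saturated; clear -nl.
  by shift_columns i; move=> *; lia.
have E0 : (c i + S_ a i = l)%N \/ (c i + c (i + 1) + L_ a i = k + l)%N.
  have [_ _ /(_ (i - 1))] := Ca; have := carrier_max Hc i.
  have := carrier_S Hc i; have := carrier_L Hc i.
  move: s_i; rewrite /saturated; clear -nl.
  by shift_columns i; move=> *; lia.
have cj : (0 < c (i + 3 - 1))%N.
  have -> : i + 3 - 1 = i + 2 by lia.
  by move: E3 E2 L1 L2; clear -nl; lia.
split=> //; first by lia.
- apply: shifted_carrierP => // [|m /near_columns Hm]; first by lia.
  have c'E m' : m' != i - 1 -> m' != i + 2 -> shifted_carrier (i + 3) m' = c m'.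
    by move=> ? ?; apply: shifted_carrier_id; lia.
  have c'2 : (shifted_carrier (i + 3) (i + 2)).+1 = c (i + 2).
    by have := @shifted_carrierE (i + 3) (i + 2) ltac:(lia) cj; lia.
  have [Sa0 Sa1 Sa2 Sa3] := hop_S_near; have [La_1 La0 La1 La2 La3] := hop_L_near.
  have := carrier_S Hc m; have := carrier_L Hc m; have := carrier_L1 Hc m.
  have := carrier_max Hc m.
  have := c'E i; have := c'E (i + 1); have := c'E (i + 3); have := c'E (i + 4).
  move: c'2 Sa0 Sa1 Sa2 Sa3 La_1 La0 La1 La2 La3 E0 T1 E2 E3 L1 L2 S1 S2.
  rewrite /carrier_at; clear -nl Hm.
  by case: Hm => [|[|[|]]] ->; shift_columns i; move=> *; split; lia.
- have [_ CS CL] := Ca.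
  apply: largest_after; try lia; last first.
    move=> m *; have -> : m = i + 4 by lia.
    have := passes_L Hb (i + 4); have := carrier_L Hc (i + 4).
    have := carrier_max Hc (i + 1); have := CL i.
    have := L_S a i; have := L_S a (i + 1).
    move: E3 E2 S1 L1; clear -nl.
    by shift_columns i; move=> *; lia.
  have := passes_S Hb (i + 3); have := passes_L Hb (i + 3).
  have := carrier_max Hc (i + 3); have := carrier_max Hc (i + 1).
  have := carrier_L Hc i; have := carrier_L Hc (i + 1).
  have := carrier_L1 Hc (i + 2); have := carrier_L Hc (i + 2).
  have := carrier_S Hc (i + 3); have := carrier_S Hc i; have := CS i; have := CL i.
  have := L_S a (i - 1); have := L_S a i; have := L_S a (i + 1).
  have := L_S a (i + 2); have := L_S a (i + 3).
  move: E0 T1 E2 E3 S1 L1 L2 s_i; rewrite /saturated; clear -nl.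
  by shift_columns i; move=> *; lia.
Qed.

Lemma hop_lands_2 : (c (i + 3)%R + L_ a (i + 2)%R < k + l)%N ->
  (c (i + 2)%R + c (i + 3)%R + L_ a (i + 2)%R < k + l)%N ->
  (c (i + 2)%R + L_ a (i + 1)%R < k + l)%N ->
  hop_lands (i + 2).
Proof.
move=> E3 F2 G2; have [_ CS CL] := Ca.
have [S1 L1] := unsaturated Ca Hi (m := i + 1) ltac:(lia).
have [S2 L2] := unsaturated Ca Hi (m := i + 2) ltac:(lia).
have s_i := Hi.1.
have E2 : (c (i + 2) + S_ a (i + 2) = l)%N.
  have := carrier_max Hc (i + 2); move: F2 G2; clear -nl.
  by shift_columns i; move=> *; lia.
have E1 : (c (i + 1) + S_ a (i + 1) = l)%N \/
    (c (i + 1) + c (i + 2) + L_ a (i + 1) = k + l)%N.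
  have := carrier_max Hc (i + 1); have := carrier_L Hc (i + 1).
  have := CS (i - 1); have := L_S a (i - 1); have := L_S a i.
  move: E2 F2 G2 S1; clear -nl.
  by shift_columns i; move=> *; lia.
have E0 : (c i + S_ a i = l)%N \/ (c i + c (i + 1) + L_ a i = (k + l).+1)%N.
  have := carrier_max Hc i; have := carrier_L Hc (i + 1).
  have := CS (i - 1); have := CL (i - 1); have := carrier_S Hc i.
  have := L_S a (i - 1); have := L_S a i; have := carrier_L Hc i.
  move: E2 F2 G2 s_i; rewrite /saturated; clear -nl.
  by shift_columns i; move=> *; lia.
have cj : (0 < c (i + 2 - 1))%N.
  have -> : i + 2 - 1 = i + 1 by lia.
  by move: E1 G2 S1; clear -nl; lia.
split=> //; first by lia.
- apply: shifted_carrierP => // [|m /near_columns Hm]; first by lia.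
  have c'E m' : m' != i - 1 -> m' != i + 1 -> shifted_carrier (i + 2) m' = c m'.
    by move=> ? ?; apply: shifted_carrier_id; lia.
  have c'1 : (shifted_carrier (i + 2) (i + 1)).+1 = c (i + 1).
    by have := @shifted_carrierE (i + 2) (i + 1) ltac:(lia) cj; lia.
  have [Sa0 Sa1 Sa2 Sa3] := hop_S_near; have [La_1 La0 La1 La2 La3] := hop_L_near.
  have := carrier_S Hc m; have := carrier_L Hc m; have := carrier_L1 Hc m.
  have := carrier_max Hc m.
  have := c'E i; have := c'E (i + 2); have := c'E (i + 3); have := c'E (i + 4).
  move: c'1 Sa0 Sa1 Sa2 Sa3 La_1 La0 La1 La2 La3 E0 E1 E2 F2 G2 E3 L1 L2 S1 S2.
  rewrite /carrier_at; clear -nl Hm.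
  by case: Hm => [|[|[|]]] ->; shift_columns i; move=> *; split; lia.
- apply: largest_after.
  + have := passes_S Hb (i + 2); have := passes_L Hb (i + 2).
    have := carrier_max Hc i; have := carrier_S Hc i; have := carrier_L Hc (i + 1).
    have := CS (i - 1); have := CL (i - 1).
    have := L_S a (i - 1); have := L_S a i; have := L_S a (i + 1).
    move: E0 E1 E2 F2 G2 S1 L1 s_i; rewrite /saturated; clear -nl.
    by shift_columns i; move=> *; lia.
  + move=> m *; have -> : m = i + 3 by lia.
    have := passes_S Hb (i + 3); have := carrier_S Hc (i + 3).
    have := CS i; have := L_S a i; have := L_S a (i + 1).
    move: E1 E2 F2 G2 S1; clear -nl.
    by shift_columns i; move=> *; lia.
  + move=> m *; have : m = i + 3 \/ m = i + 4 by lia.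
    case=> ->.
      have := passes_L Hb (i + 3); have := carrier_L Hc (i + 3).
      have := carrier_S Hc (i + 4); have := carrier_max Hc i.
      have := CS (i - 1); have := CS i; have := CL (i - 1).
      have := L_S a (i - 1); have := L_S a i; have := L_S a (i + 1).
      have := L_S a (i + 2).
      move: E0 E1 E2 F2 G2 E3 S1 L1; clear -nl.
      by shift_columns i; move=> *; lia.
    have := passes_L Hb (i + 4); have := carrier_L Hc (i + 4).
    move: E2 S2; clear -nl.
    by shift_columns i; move=> *; lia.
Qed.

End Commute.

Definition crosses (k l : nat) (a b : config) : Prop :=
  exists2 c, carrier k l a c & passes a b c.

Lemma crosses_total k l a : (l <= k)%N -> inC k l a -> exists b, crosses k l a b.
Proof.
move=> lk Ca; have [c Hc] := carrier_exists lk Ca.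
by have [b Hb] := passes_exists lk Ca Hc; exists b, c.
Qed.

Lemma crosses_inC k l a b : (l <= k)%N -> inC k l a -> crosses k l a b ->
  inC k l b.
Proof. by move=> lk Ca [c Hc Hb]; exact: (passes_inC Hb Hc lk Ca Ca). Qed.

Section CrossesMove.
Variables (k l n : nat).
Hypotheses (n0 : (0 < n)%N) (nl : (n <= l)%N) (lk : (l <= k)%N).

(** The three columns in which the hop can land exhaust all cases, and in each
    of them the hop is the right move of [b]. *)
Lemma crosses_Mplus a b : inCunder k n a -> crosses k l a b ->
  inCunder k n b /\ crosses k l (Mplus k n a) (Mplus k n b).
Proof.
move=> Ua [c Hc Hb]; have [Ca _] := Ua; have Hi := move_colP n0 Ua.
have H := Mplus_hop n0 Ua; set i := move_col k n a in Hi H.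
have [j [ij cj Hc' Hj]] : exists j, hop_lands k l n (Mplus k n a) b c i j.
  have [far|far] := eqVneq (c (i + 3)%R + L_ a (i + 2)%R)%N (k + l)%N.
    by exists (i + 4); exact: (hop_lands_4 H Hb Hc n0 nl Ca Hi).
  have far' : (c (i + 3)%R + L_ a (i + 2)%R < k + l)%N.
    have := carrier_L1 Hc (i + 3); have -> : i + 3 - 1 = i + 2 by lia.
    lia.
  have := carrier_L Hc (i + 2); have := carrier_L1 Hc (i + 2).
  have -> : i + 2 - 1 = i + 1 by lia.
  have -> : i + 2 + 1 = i + 3 by lia.
  rewrite leq_eqVlt => /orP[/eqP mid _|mid].
    by exists (i + 3); apply: (hop_lands_3 H Hb Hc n0 nl Ca Hi far'); right.
  rewrite leq_eqVlt => /orP[/eqP mid'|mid'].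
    by exists (i + 3); apply: (hop_lands_3 H Hb Hc n0 nl Ca Hi far'); left.
  by exists (i + 2); exact: (hop_lands_2 H Hb Hc n0 nl Ca Hi far' mid' mid).
have Ub : inCunder k n b.
  apply/inCunderP => //; split; last by exists j; case: Hj.
  exact: (passes_inC Hb Hc lk (inC_le nl Ca) Ca).
split=> //; exists (shifted_carrier c i j) => //.
have ij' : i + 2 <= j by lia.
have Hbb' := Mplus_hop n0 Ub; rewrite (move_colE Hj) in Hbb'.
exact: (passes_hop H Hb ij' cj Hbb').
Qed.

Lemma crosses_iter a b t : inCunder k n a -> crosses k l a b ->
  crosses k l (iter t (Mplus k n) a) (iter t (Mplus k n) b).
Proof.
move=> Ua Hab; elim: t => //= t IH.
by case: (crosses_Mplus (iter_Mplus_inCunder t n0 Ua) IH).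
Qed.

End CrossesMove.

(** * Crossing an isolated particle *)

(** Next to empty columns only the bound [l - S_m] is active: the travelling
    particle moves as a whole. *)
Lemma carrier_empty k l a c (m : int) : (l <= k)%N -> carrier k l a c ->
  S_ a m = 0%N -> (L_ a m + l <= k)%N -> (L_ a (m - 1) <= k)%N -> c m = l.
Proof.
move=> lk Hc Sm Lm Lm1; have := carrier_max Hc m; have := carrier_S Hc m.
by have := carrier_S Hc (m + 1); rewrite Sm; lia.
Qed.

(** An isolated particle of weight [n] sits in the single column [X] of [a], to
    the right of [abar].  When a particle of weight [l] has crossed it, it has
    become the free particle in the columns [X + 2] and [X + 3] that carries
    [n - e] and [e] units, where [e = max (l + n - k) 0], so that its energy has
    increased by [A_ k l n]; and the traveller goes on as if the isolated
    particle had never been there, the empty columns to the left of [X] being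
    enough for the carrier to return to the value [l]. *)
Section Crossing.
Variables (k l n : nat) (a b abar bbar : config) (c cbar : int -> nat) (X : int).
Hypotheses (n0 : (0 < n)%N) (nl : (n <= l)%N) (lk : (l <= k)%N).
Hypotheses (aX : a X = n) (aXr : forall m : int, X < m -> a m = 0%N)
  (aXl : forall m : int, X - 8 < m -> m < X -> a m = 0%N).
Hypothesis Hbar : abar = remove_particle a X.
Hypotheses (Hc : carrier k l a c) (Hcbar : carrier k l abar cbar)
  (Hb : passes a b c) (Hbbar : passes abar bbar cbar).

Lemma residue_E (m : int) : abar m = if m == X then 0%N else a m.
Proof.
rewrite Hbar remove_particleE; case: eqVneq => //= _.
by case: eqVneq => // ->; rewrite aXr //; lia.
Qed.

Lemma residue_near (m : int) : X - 8 < m -> abar m = 0%N.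
Proof.
by move=> mX; rewrite residue_E; case: eqVneq => // ?;
  have [?|?] := ltP m X; [apply: aXl | apply: aXr; lia].
Qed.

Lemma residue_carrier_near (m : int) : X - 5 < m -> cbar m = l.
Proof.
by move=> mX; apply: (carrier_empty lk Hcbar); rewrite /S_ /L_ !residue_near; lia.
Qed.

Lemma carrier_right_of_particle (m : int) : X + 2 <= m -> c m = l.
Proof.
move=> mX; have [->|?] := eqVneq m (X + 2); last first.
  by apply: (carrier_empty lk Hc); rewrite /S_ /L_ !aXr; lia.
apply: (carrier_empty lk Hc); rewrite /S_ /L_; shift_columns X.
- by rewrite !aXr; lia.
- by rewrite !aXr; lia.
- rewrite aX (aXr (m := X + 1%:Z)) ?(aXr (m := X + 2%:Z)).
  all: by rewrite ?(aXr (m := X + 3%:Z)); lia.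
Qed.

Lemma carrier_at_particle : [/\ c (X + 1) = minn l (k - n), c X = (l - n)%N,
  c (X - 1) = (l - n)%N, c (X - 2) = l & c (X - 3) = l].
Proof.
have c2 := carrier_right_of_particle (m := X + 2) ltac:(lia).
have az (z : int) : (- 8 < z) && (z != 0) -> a (X + z) = 0%N.
  move=> /andP[z8 z0]; have [?|?] := ltP z 0; first by apply: aXl; lia.
  by apply: aXr; lia.
have S2 : [/\ S_ a (X + 1) = 0%N, S_ a X = n, S_ a (X - 1) = n, S_ a (X - 2) = 0%N &
    S_ a (X - 3) = 0%N].
  by rewrite /S_; shift_columns X; rewrite !az // aX; split; lia.
have L2 : [/\ L_ a (X + 1) = n, L_ a X = n.*2, L_ a (X - 1) = n.*2,
    L_ a (X - 2) = n & L_ a (X - 3) = 0%N /\ L_ a (X - 4) = 0%N].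
  by rewrite /L_; shift_columns X; rewrite !az // aX; split; lia.
have [S1 S0 S_1 S_2 S_3] := S2; have [L1 L0 L_1 L_2 [L_3 L_4]] := L2.
have c1 : c (X + 1) = minn l (k - n).
  have := carrier_max Hc (X + 1); have := carrier_S Hc (X + 1).
  have := carrier_L Hc (X + 1); have := carrier_L1 Hc (X + 1).
  by move: c2 S1 L1 L0; clear -nl lk; shift_columns X; move=> *; lia.
have c0 : c X = (l - n)%N.
  have := carrier_max Hc X; have := carrier_S Hc X.
  have := carrier_L Hc X; have := carrier_L1 Hc X.
  by move: c1 S0 L0 L_1; clear -nl lk; shift_columns X; move=> *; lia.
have c_1 : c (X - 1) = (l - n)%N.
  have := carrier_max Hc (X - 1); have := carrier_S Hc (X - 1).
  have := carrier_L Hc (X - 1); have := carrier_L1 Hc (X - 1).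
  by move: c0 S_1 L_1 L_2; clear -nl lk; shift_columns X; move=> *; lia.
have c_2 : c (X - 2) = l.
  have := carrier_max Hc (X - 2); have := carrier_S Hc (X - 2).
  have := carrier_L Hc (X - 2); have := carrier_L1 Hc (X - 2).
  by move: c_1 S_2 L_2 L_3; clear -nl lk; shift_columns X; move=> *; lia.
split=> //; apply: (carrier_empty lk Hc); rewrite ?L_3 //.
have -> : X - 3 - 1 = X - 4 by lia.
by rewrite L_4.
Qed.

Lemma carrier_left_of_particle (m : int) : m <= X - 3 -> c m = cbar m.
Proof.
move=> mX; have [_ _ _ _ c3] := carrier_at_particle.
apply: (carrier_agree Hc Hcbar _ _ _ mX).
- by move=> m' ?; rewrite /S_ !residue_E !ifF //; lia.
- by move=> m' ?; rewrite /L_ !residue_E !ifF //; lia.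
- by rewrite c3 residue_carrier_near //; lia.
Qed.

Lemma crossed_particle : exists i,
  [/\ free_particle n b i, bbar = remove_particle b i &
    particle_energy n b i = n%:Z * X + (A_ k l n)%:Z].
Proof.
have [c1 c0 c_1 c_2 c_3] := carrier_at_particle.
have c2 := carrier_right_of_particle (m := X + 2) ltac:(lia).
have bm (m : int) : m <= X - 2 -> b m = bbar m.
  move=> mX; have := Hb m; have := Hbbar m.
  by rewrite !carrier_left_of_particle ?residue_E ?ifF; lia.
have bbar0 (m : int) : X - 3 < m -> bbar m = 0%N.
  by move=> mX; have := Hbbar m; rewrite !residue_carrier_near ?residue_near; lia.
have br (m : int) : X + 3 < m -> b m = 0%N.
  by move=> mX; have := Hb m; rewrite !carrier_right_of_particle ?aXr; lia.
have b2 : b (X + 2) = (minn l (k - n) - (l - n))%N.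
  have := Hb (X + 2); rewrite aXr; last by lia.
  by move: c1 c0; clear -nl lk; shift_columns X; move=> *; lia.
have b3 : b (X + 3) = (l - minn l (k - n))%N.
  have := Hb (X + 3); rewrite aXr; last by lia.
  by move: c1 c2; clear -nl lk; shift_columns X; move=> *; lia.
have b1 : b (X + 1) = 0%N.
  have := Hb (X + 1); rewrite aXr; last by lia.
  by move: c0 c_1; clear -nl lk; shift_columns X; move=> *; lia.
have b0 : b X = 0%N.
  by have := Hb X; move: c_1 c_2 aX; clear -nl lk; shift_columns X; move=> *; lia.
have b_1 : b (X - 1) = 0%N.
  have := Hb (X - 1); rewrite aXl; [|lia..].
  by move: c_2 c_3; clear -nl lk; shift_columns X; move=> *; lia.
have b23 : (b (X + 2)%R + b (X + 3)%R = n)%N by rewrite b2 b3; lia.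
have rem (i : int) (Hi : i = X + 2 \/ i = X + 3 /\ b (X + 2) = 0%N) :
    bbar = remove_particle b i.
  apply/fsfunP => m; rewrite remove_particleE.
  have [?|?] := leP m (X - 2); first by rewrite bm // ifF //; lia.
  rewrite bbar0; last by lia.
  have : m = X - 1 \/ m = X \/ m = X + 1 \/ m = X + 2 \/ m = X + 3 \/ X + 3 < m by lia.
  case: ifP => // nm [->|[->|[->|[E|[E|?]]]]];
    [by rewrite b_1|by rewrite b0|by rewrite b1| | |by rewrite br].
  - by rewrite E; case: Hi => [e|[_ ->] //]; move: nm; rewrite E e eqxx.
  - by move: nm; rewrite E; case: Hi => [->|[-> _]]; lia.
have [z2|nz2] := eqVneq (b (X + 2)) 0%N.
  exists (X + 3); split.
  - split; [rewrite (br (X + 3 + 1)); lia | lia | by move=> j ?; apply: br; lia].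
  - by apply: rem; right.
  - have -> : particle_energy n b (X + 3) = n%:Z * (X + 3).
      by rewrite /particle_energy; have -> : b (X + 3) = n; [lia | nia].
    by move: z2; rewrite b2 /A_; nia.
exists (X + 2); have E : X + 2 + 1 = X + 3 by lia.
split.
- by split; [rewrite E | lia | move=> j ?; apply: br; lia].
- by apply: rem; left.
- have -> : particle_energy n b (X + 2) = n%:Z * (X + 3) - (b (X + 2))%:Z.
    by rewrite /particle_energy; nia.
  by rewrite b2 /A_; nia.
Qed.

End Crossing.

(** * Riggings and heights *)

Definition shift_riggings (k l : nat) (p : seq nat * seq int) :=
  (p.1, [seq x.2 + (A_ k l x.1)%:Z | x <- zip p.1 p.2]).

Lemma particle_energy_col n b i (X : int) : (0 < n)%N ->
  free_particle n b i -> particle_energy n b i = n%:Z * X -> i = X /\ b X = n.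
Proof.
move=> n0 [bn bi _]; rewrite /particle_energy => E.
have E' : n%:Z * (X - i) = n%:Z - (b i)%:Z by nia.
have iX : i = X.
  have [?|?|//] := ltgtP i X; last by nia.
  have : n%:Z * 1 <= n%:Z * (X - i) by rewrite ler_pM2l; lia.
  lia.
by subst i; split=> //; nia.
Qed.

Lemma A_sym k l m : A_ k l m = A_ k m l.
Proof. by rewrite /A_ minnC (addnC l). Qed.

Lemma inCunder_level_le k l n a : inC k l a -> inCunder k n a -> (n <= l)%N.
Proof.
move=> Ca [_ nC]; rewrite leqNgt; apply/negP => ln; apply: nC.
by apply: (inC_le _ Ca); lia.
Qed.

Lemma peels_inC k n a s abar : (0 < n)%N -> inCunder k n a ->
  peels_to k n a s abar -> inC k n abar.
Proof.
move=> n0 Ua [T /(_ T (leqnn T)) [i [_ _ ->]]]; apply: inC_remove.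
by case: (iter_Mplus_inCunder T n0 Ua).
Qed.

(** Crossing commutes with the right moves, so the particle peeled off [b] can be
    computed from a late time, when the particle of [a] is isolated. *)
Lemma crosses_peels_to k l n a b s abar bbar : (0 < n)%N -> (n <= l <= k)%N ->
  inCunder k n a -> crosses k l a b ->
  peels_to k n a s abar -> crosses k l abar bbar ->
  peels_to k n b (s + (A_ k l n)%:Z) bbar.
Proof.
move=> n0 /andP[nl lk] Ua Hab [T HT] [cbar Hcbar Hbbar].
have [R HR] := config_bound abar.
(* A time at which the peeled particle occupies a single column X, far to the
   right of everything else. *)
pose X : int := `|R| + 10 + T%:Z + `|s|.
have nX : X <= n%:Z * X by rewrite -[X in X <= _]mul1r ler_pM2r; lia.
pose t := absz (n%:Z * X - s)%R.
have Et : t%:Z = n%:Z * X - s by lia.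
have Tt : (T <= t)%N by lia.
have [i [Hf Es Eabar]] := HT t Tt.
have Ee : particle_energy n (iter t (Mplus k n) a) i = n%:Z * X by lia.
have [iX aX] := particle_energy_col n0 Hf Ee; subst i.
have [c Hc Hb] := crosses_iter n0 nl lk t Ua Hab.
have [i' [Hf' Er Ee']] : exists i,
    [/\ free_particle n (iter t (Mplus k n) b) i,
     bbar = remove_particle (iter t (Mplus k n) b) i &
     particle_energy n (iter t (Mplus k n) b) i = n%:Z * X + (A_ k l n)%:Z].
  apply: (crossed_particle _ _ _ aX _ _ Eabar Hc Hcbar Hb Hbbar) => //.
  - move=> m Xm; have [a1 a2 a3] := Hf.
    have [->|?] := eqVneq m (X + 1); first by move: a1; rewrite aX; lia.
    by apply: a3; lia.
  - move=> m ? ?; have := HR m; rewrite Eabar remove_particleE ifF; last by lia.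
    by apply; lia.
have Ub : inCunder k n b by case: (crosses_Mplus n0 nl lk Ua Hab).
rewrite Er; have <- : particle_energy n (iter t (Mplus k n) b) i' - t%:Z
    = s + (A_ k l n)%:Z by lia.
by apply: free_peels_to => //; rewrite n0; lia.
Qed.

Lemma carrier_zero k l a c : (l <= k)%N -> a = zero_config ->
  carrier k l a c -> forall m, c m = l.
Proof.
move=> lk -> Hc m; apply: (carrier_empty lk Hc);
  by rewrite /S_ /L_ !fsfun0E.
Qed.

(** The crossing of a particle of weight [l] keeps all weights and raises the
    rigging of each particle of weight [m] by the interaction [A_ k l m]: the
    positions [s] are shifted by [crosses_peels_to], and what is left after the
    peeling is again related by a crossing. *)
Lemma crosses_iota k a p : iota_graph k a p -> forall l b, (l <= k)%N ->
  inC k l a -> crosses k l a b -> iota_graph k b (shift_riggings k l p).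
Proof.
elim=> [|{}a abar n s lam rho lk' Ua Hp _ IH] l b lk Ca Hab.
  have [c Hc Hb] := Hab.
  have -> : b = zero_config; last exact: iota_zero.
  apply/fsfunP => m; have := Hb m; rewrite !(carrier_zero lk _ Hc) // !fsfun0E.
  lia.
have nl := inCunder_level_le Ca Ua; have /andP[n0 _] := lk'.
have Cabar : inC k l abar := inC_le nl (peels_inC n0 Ua Hp).
have [bbar Hbar] := crosses_total lk Cabar.
have := IH _ _ lk Cabar Hbar => Hg.
rewrite /shift_riggings /= addrAC.
apply: iota_cons lk' _ _ Hg; first by case: (crosses_Mplus n0 nl lk Ua Hab).
by apply: (crosses_peels_to n0 _ Ua Hab Hp Hbar); exact/andP.
Qed.

Lemma peels_to_uniq k n a s abar s' abar' : (0 < n)%N ->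
  peels_to k n a s abar -> peels_to k n a s' abar' -> s = s' /\ abar = abar'.
Proof.
move=> n0 [T HT] [T' HT'].
have [i [[bn bi b0] -> ->]] := HT (T + T')%N (leq_addr _ _).
have [i' [[bn' bi' b0'] -> ->]] := HT' (T + T')%N (leq_addl _ _).
move: bn bi b0 bn' bi' b0'; set b := iter _ _ _ => bn bi b0 bn' bi' b0'.
suff -> : i = i' by [].
have [lt|lt|//] := ltgtP i i'.
- have [e|?] := eqVneq i' (i + 1); last by case: bi'; apply: b0; lia.
  by case: bi; move: bn'; rewrite (b0 (i' + 1)); [rewrite e; lia|lia].
- have [e|?] := eqVneq i (i' + 1); last by case: bi; apply: b0'; lia.
  by case: bi'; move: bn; rewrite (b0' (i + 1)); [rewrite e; lia|lia].
Qed.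

Lemma free_determined n b b' i i' : (0 < n)%N ->
  free_particle n b i -> free_particle n b' i' ->
  particle_energy n b i = particle_energy n b' i' ->
  remove_particle b i = remove_particle b' i' -> b = b'.
Proof.
move=> n0 [bn bi b0] [bn' bi' b0']; rewrite /particle_energy => Ee Er.
have E' : n%:Z * (i - i') = (b i)%:Z - (b' i')%:Z by nia.
have ii : i = i'.
  have [?|?|//] := ltgtP i i'.
  - have : n%:Z * (i - i') <= n%:Z * (-1) by rewrite ler_pM2l; lia.
    lia.
  - have : n%:Z * 1 <= n%:Z * (i - i') by rewrite ler_pM2l; lia.
    lia.
subst i'; have bb : b i = b' i by nia.
apply/fsfunP => m.
have := congr1 (fun f : config => f m) Er; rewrite !remove_particleE.
by case: ifP => // /orP[/eqP ->|/eqP ->] _ //; lia.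
Qed.

(** The right-hand side says that [n] units can be added to [abar] in column [N]
    without leaving level [n].  It is equivalent to the carrier being full,
    [c m = n], down to [m = N - 1], since the first obstacle to a full carrier
    is precisely one of these bounds; and a carrier that is full up to there is
    one that leaves nothing beyond column [N]. *)
Lemma crosses_height k n abar g (N : int) : (n <= k)%N -> inC k n abar ->
  crosses k n abar g ->
  (forall m : int, N < m -> g m = 0%N) <->
  (forall m : int, N - 1 <= m -> abar m = 0%N) /\
  (abar (N - 2)%R + n <= k)%N /\
  (abar (N - 3)%R + 2 * abar (N - 2)%R <= k)%N.
Proof.
move=> nk Ca [c Hc Hg]; have [M HM] := carrier_right Hc.
split=> [gN|[aN [a2 a3]] m Nm].
  have cn (m : int) : N - 1 <= m -> c m = n.
    have H (d : nat) (m' : int) : `|M| + `|N| - d%:Z <= m' -> N - 1 <= m' -> c m' = n.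
      elim: d m' => [|d IH] m' dm Nm; first by apply: HM; lia.
      have := Hg (m' + 2); rewrite gN; last by lia.
      have -> : m' + 2 - 2 = m' by lia.
      have -> : m' + 2 - 1 = m' + 1 by lia.
      by rewrite (IH (m' + 1)); [have := carrier_S Hc m'; lia | lia..].
    by move=> Nm; apply: (H (absz (`|M| + `|N| - m)%R)); lia.
  have aN (m : int) : N - 1 <= m -> abar m = 0%N.
    by move=> Nm; have := carrier_S Hc m; rewrite cn // /S_; lia.
  have := carrier_L Hc (N - 1); have := carrier_L1 Hc (N - 1).
  rewrite /L_ !cn; [|lia..].
  have := aN (N - 1); have := aN N; have := aN (N + 1).
  by shift_columns N => *; split; [exact: aN | lia].
have cn (m' : int) : N - 1 <= m' -> c m' = n.
  move=> Nm'.
  have [->|?] := eqVneq m' (N - 1).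
    apply: (carrier_empty nk Hc); move: a2 a3; rewrite /S_ /L_;
      shift_columns N; rewrite ?(aN (N - 1)) ?(aN N) ?(aN (N + 1)); lia.
  have [->|?] := eqVneq m' N.
    apply: (carrier_empty nk Hc); move: a2 a3; rewrite /S_ /L_;
      shift_columns N;
      rewrite ?(aN (N - 1)) ?(aN N) ?(aN (N + 1)) ?(aN (N + 2)); lia.
  by apply: (carrier_empty nk Hc); rewrite /S_ /L_ !aN; lia.
have := Hg m; rewrite !cn ?aN; lia.
Qed.

Lemma iter_hop_height k n a t (N : int) : (0 < n)%N -> inCunder k n a ->
  (forall m : int, N < m -> iter t (Mplus k n) a m = 0%N) ->
  forall m : int, N < m -> a m = 0%N.
Proof.
move=> n0 Ua; elim: t => //= t IH H; apply: IH.
exact: hop_height (Mplus_hop n0 (iter_Mplus_inCunder t n0 Ua)) H.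
Qed.

(** The induction step.  If [a] stays below the wall [N], then it can be moved
    until its heaviest particle fills column [N], so [s <= n N] and there is
    room for [n] units in that column next to [abar].  Conversely, if there is
    room, let [w] be [abar] with these [n] units; [w] and [a] end up with the
    same free particle, so [w] is a right-moved [a] because the right move is
    injective, and right moves never lower the height. *)
Lemma height_peel k n a s abar g (N : int) : (0 < n <= k)%N -> inCunder k n a ->
  peels_to k n a s abar -> crosses k n abar g ->
  (forall m : int, N < m -> a m = 0%N) <->
  s <= n%:Z * N /\ (forall m : int, N < m -> g m = 0%N).
Proof.
move=> nk Ua Hp Hg; have /andP[n0 nk'] := nk.
have Cabar := peels_inC n0 Ua Hp.
rewrite (crosses_height N nk' Cabar Hg); split.
  move=> aN; have [M HM] := config_bound a.
  have Wa : in_window N (absz (`|N| + `|M|)%R + absz N)%N a.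
    by move=> m nm; have [?|?] := ltP N m; [exact: aN | apply: HM; lia].
  have [t /= [Wb bN bN1 _]] := reach_wall nk Ua Wa.
  have Ub := iter_Mplus_inCunder t n0 Ua; set b := iter _ _ _ in Wb bN bN1 Ub.
  have b0 (m : int) : N < m -> b m = 0%N by move=> ?; apply: Wb; lia.
  have Hf := wall_free n0 bN b0.
  have [-> ->] := peels_to_uniq n0 Hp (free_peels_to nk Ua Hf).
  rewrite (wall_energy bN) -/b; split; first by lia.
  have bar (m : int) : N - 1 <= m -> remove_particle b N m = 0%N.
    move=> Nm; rewrite remove_particleE; case: ifP => // /negbT nmN.
    by have [->|?] := eqVneq m (N - 1) => //; apply: b0; lia.
  have [_ _ CL] := Ub.1; split; first exact: bar.
  rewrite !remove_particleE !ifF; [|lia..].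
  move: (CL (N - 1)) (CL (N - 2)) bN bN1 (b0 (N + 1)); rewrite /L_.
  by shift_columns N; lia.
move=> [sN [aN [a2 a3]]].
pose w : config := [fsfun abar with N |-> n].
have wE m : w m = if m == N then n else abar m by rewrite fsfun_withE.
have wN : w N = n by rewrite wE eqxx.
have w0 (m : int) : N < m -> w m = 0%N by move=> ?; rewrite wE ifF ?aN; lia.
have Uw : inCunder k n w.
  apply/inCunderP => //; split; last first.
    by exists N; left; rewrite /S_ wN w0; lia.
  have w_1 : w (N - 1) = 0%N by rewrite wE ifF ?aN //; lia.
  have w_2 : w (N - 2) = abar (N - 2) by rewrite wE ifF //; lia.
  have w_3 : w (N - 3) = abar (N - 3) by rewrite wE ifF //; lia.
  have w1 : [/\ w (N + 1) = 0%N, w (N + 2) = 0%N & w (N + 3) = 0%N].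
    by split; apply: w0; lia.
  have wl (m : int) : m < N -> w m = abar m by move=> ?; rewrite wE ifF //; lia.
  have [Ck CS CL] := Cabar.
  have near (m : int) : m + 2 < N \/ N + 1 < m \/
      m = N - 2 \/ m = N - 1 \/ m = N \/ m = N + 1 by lia.
  split=> m; rewrite /S_ /L_; have [?|[?|Hm]] := near m.
  - by rewrite !wl; [exact: Ck | lia..].
  - by rewrite !w0; lia.
  - move: w_1 w_2 w1 wN a2 a3; case: Hm => [|[|[|]]] ->; shift_columns N;
    by move=> ? ? [? ? ?]; lia.
  - by rewrite !wl; [exact: CS | lia..].
  - by rewrite !w0; lia.
  - move: w_1 w_2 w1 wN a2 a3 (CS (N - 2)); rewrite /S_.
    by case: Hm => [|[|[|]]] ->; shift_columns N; move=> ? ? [? ? ?]; lia.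
  - by rewrite !wl; [exact: CL | lia..].
  - by rewrite !w0; lia.
  - move: w_1 w_2 w_3 w1 wN a2 a3.
    by case: Hm => [|[|[|]]] ->; shift_columns N; move=> ? ? ? [? ? ?]; lia.
have Hfw := wall_free n0 wN w0.
have rw : remove_particle w N = abar.
  apply/fsfunP => m; rewrite remove_particleE wE.
  have [->|?] := eqVneq m N; first by rewrite aN //; lia.
  by case: eqVneq => //= ->; rewrite aN //; lia.
have [T HT] := Hp.
have Hpw : peels_to k n w (n%:Z * N) abar.
  have := @free_peels_to k n w 0 N nk Uw Hfw; rewrite /= (wall_energy wN) rw subr0.
  by [].
have [T' HT'] := Hpw.
pose d := absz (n%:Z * N - s)%R.
have [i [Hf Es Er]] := HT (T + T' + d)%N ltac:(lia).
have [i' [Hf' Es' Er']] := HT' (T + T')%N ltac:(lia).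
have E : iter (T + T' + d) (Mplus k n) a = iter (T + T') (Mplus k n) w.
  by apply: (free_determined n0 Hf Hf'); [lia | rewrite -Er -Er'].
rewrite iterD in E.
have Ew := iter_Mplus_inj n0 (iter_Mplus_inCunder d n0 Ua) Uw E.
by apply: (iter_hop_height (t := d) n0 Ua); rewrite Ew.
Qed.

Definition riggings_bounded (k : nat) (N : int) (lam : seq nat) (rho : seq int) :=
  forall i : 'I_(size lam),
     rho`_i <= (nth 0%N lam i)%:Z * N
       - \sum_(j < size lam | j != i)
           (A_ k (nth 0%N lam i) (nth 0%N lam j))%:Z.

Lemma iota_size k a p : iota_graph k a p -> size p.2 = size p.1.
Proof. by elim=> //= {}a abar l s lam rho _ _ _ _ ->. Qed.

Lemma nth_shift_riggings k l lam rho i : size rho = size lam ->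
  (i < size lam)%N ->
  (shift_riggings k l (lam, rho)).2`_i = rho`_i + (A_ k l (nth 0%N lam i))%:Z.
Proof.
move=> E il; rewrite /shift_riggings /= (nth_map (0%N, 0)) ?size_zip ?E ?minnn //.
by rewrite nth_zip.
Qed.

(** The first particle enters the inequality of any other particle as a shift of
    its rigging by the interaction of the two. *)
Lemma riggings_bounded_cons k N n s lam rho : size rho = size lam ->
  riggings_bounded k N (n :: lam)
    ((s - (\sum_(m <- lam) A_ k n m)%N%:Z) :: rho) <->
  s <= n%:Z * N /\ riggings_bounded k N lam (shift_riggings k n (lam, rho)).2.
Proof.
move=> E; rewrite /riggings_bounded /=.
have head : \sum_(j < (size lam).+1 | j != ord0) (A_ k n (nth 0%N (n :: lam) j))%:Z
    = (\sum_(m <- lam) A_ k n m)%N%:Z :> int.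
  rewrite big_mkcond big_ord_recl /= add0r (big_nth 0%N) big_mkord.
  by rewrite -[RHS]natz (big_morph _ (natrD int) (erefl _)); apply: eq_bigr => i _;
    rewrite natz.
have tail (i : 'I_(size lam)) :
    \sum_(j < (size lam).+1 | j != lift ord0 i)
      (A_ k (nth 0%N lam i) (nth 0%N (n :: lam) j))%:Z =
    (A_ k n (nth 0%N lam i))%:Z + \sum_(j < size lam | j != i)
      (A_ k (nth 0%N lam i) (nth 0%N lam j))%:Z :> int.
  rewrite big_mkcond big_ord_recl /= A_sym; congr (_ + _).
  by rewrite [RHS]big_mkcond.
split=> [H|[sN H] i].
  split; first by have := H ord0; rewrite head /=; lia.
  move=> i; rewrite nth_shift_riggings //.
  by have := H (lift ord0 i); rewrite tail /= add0n; lia.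
case: (unliftP ord0 i) => [i' ->|->]; last by rewrite head /=; lia.
by have := H i'; rewrite nth_shift_riggings // tail /= add0n; lia.
Qed.

(** Induction on the number of particles, with the wall [N] fixed: peeling off
    the heaviest particle and then crossing the rest by a particle of the same
    weight accounts for exactly the terms of the sums that involve this
    particle. *)
Lemma height_riggings k N a lam rho : iota_graph k a (lam, rho) -> inCk k a ->
  (forall m : int, N < m -> a m = 0%N) <-> riggings_bounded k N lam rho.
Proof.
have [n] : exists n, size lam = n by eexists.
elim: n a lam rho => [|n IH] a lam rho Hn Ha Ca.
all: inversion Ha as [|? abar l0 s lam' rho' lk Ua Hp Habar]; subst; rewrite //= in Hn.
  split=> [_ i|_ m _]; first by case: i.
  by rewrite fsfun0E.
have /andP[n0 nk] := lk; have Cabar := peels_inC n0 Ua Hp.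
have [g Hg] := crosses_total nk Cabar.
have Ig := crosses_iota Habar nk Cabar Hg.
have [Cg _ _] := crosses_inC nk Cabar Hg.
rewrite riggings_bounded_cons; last exact: iota_size Habar.
rewrite (height_peel N lk Ua Hp Hg); rewrite (IH g lam' _ _ Ig Cg) //.
by case: Hn.
Qed.

Theorem theorem4p4 (k l N : nat) (a : config) (lam : seq nat) (rho : seq int) :
  (l <= k)%N ->
  inCpos k l a ->
  (lam, rho) = iota_map k a ->
  (forall i : int, N%:Z < i -> a i = 0%N) <->
  (forall i : 'I_(size lam),
     rho`_i <= (nth 0%N lam i)%:Z * N%:Z
       - \sum_(j < size lam | j != i)
           (A_ k (nth 0%N lam i) (nth 0%N lam j))%:Z).
Proof.
move=> lk [[Ck _ _] _] E; apply: height_riggings (Ck).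
rewrite E; have [p Hp] := iota_total Ck.
exact: (@xgetPex _ ([::], [::]) [set p | iota_graph k a p]%classic
  (ex_intro _ p Hp)).
Qed.
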